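(* Let $s$ be an odd positive integer and let $D$ be a normalized difference set in an abelian group $G$ with parameters \[ \left(\frac{2^{4s}-1}{2^s-1},\,\frac{2^{3s}-1}{2^s-1},\,\frac{2^{2s}-1}{2^s-1}\right). \] Then $G$ has a subgroup $M$ of order $15$ such that $D\cap M$ is a $(15,7,3)$-difference set in $M$.
   Context: A $(v,k,\lambda)$-difference set in an abelian group $G$ of order $v$ is a $k$-subset $D$ such that every non-identity element of $G$ is of the form $d_1d_2^{-1}$ with $d_1,d_2\in D$ in exactly $\lambda$ ways. It is normalized if $\prod_{d\in D}d=1$. *)

(* Defs.v *)
From mathcomp Require Import all_boot all_fingroup.
Set Implicit Arguments. Unset Strict Implicit. Unset Printing Implicit Defensive.
Import GroupScope.
Local Open Scope group_scope.

Definition difference_set (gT : finGroupType) (G D : {set gT}) (v k lam : nat) : Prop :=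
  [/\ D \subset G, #|G| = v, #|D| = k &
      forall x, x \in G -> x != 1 ->
        #|[set p in setX D D | p.1 * p.2^-1 == x]| = lam].

(* D is normalized: the product of its elements is the identity
   (order-independent when G is abelian). *)
Definition normalized (gT : finGroupType) (D : {set gT}) : Prop :=
  \prod_(d in D) d = 1.

(* Main.v *)
Require Import Defs.
From HB Require Import structures.
From mathcomp Require Import all_boot all_fingroup.
From mathcomp Require Import all_algebra all_solvable ring.
Set Implicit Arguments. Unset Strict Implicit. Unset Printing Implicit Defensive.
Import GRing.Theory Num.Theory.

(* Write q = 2^s, so that #|G| = (q + 1)(q^2 + 1), #|D| = q^2 + q + 1 and
   D D^-1 = q^2 + (q + 1) J in Z[G], J being the sum of all group elements.

   The map x -> x^2 preserves D.  Its action on Z[G] by pullback, rho, is a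
   ring automorphism of finite order with rho (f^2) = f mod 2, so Z[G] is
   reduced modulo 2; from this, x y = 0 mod 2^m implies rho x y = 0 mod 2^m.
   Hence rho D D^-1 is congruent to a multiple of J modulo q^2, which forces
   rho D to be a translate of D, and normalization makes the translation
   trivial.

   Let A and B be the subgroups of order q + 1 and q^2 + 1 (a line and an ovoid
   in the classical case of a plane D of PG(3,q)).  Some power of 2 inverts G
   modulo A, another one modulo B, so for N in {A, B} the function
   f g = #|D :&: g N| is invariant under g -> g^-1.  So f^2 = f f^-1 is a multiple
   of J modulo q^2, whence f = 1 mod q.  The
   first two moments of f then give A \subset D, D :&: B = 1, and a single
   point of D on each coset of A other than A.

   Finally, let b have order 5 and let d be the point of D on b A.  Then d^16 is
   also in D :&: b A, so d^15 = 1; as d is neither in A nor in B it has order 15,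
   and the facts above decide which powers of d lie in D. *)

(** * The integral group ring of a finite abelian group *)

Section GroupRing.
Local Open Scope ring_scope.

(** The proof of commutativity is a parameter of the type because the commutative ring structure
    attached to the type depends on it. *)
Definition gring_of (gT : finGroupType) of abelian [set: gT] : Type :=
  {ffun gT -> int}.

Variables (gT : finGroupType) (abG : abelian [set: gT]).
Local Notation gring := (gring_of abG).

HB.instance Definition _ := GRing.Zmodule.copy gring {ffun gT -> int}.

Implicit Types (f g h : gring) (x y z : gT).

Lemma mulgC_abelian x y : (x * y = y * x)%g.
Proof. by apply: (centsP abG); rewrite inE. Qed.

Definition delta x : gring := [ffun y => (y == x)%:R].
Definition gmul f g : gring := [ffun x => \sum_y f y * g (y^-1 * x)%g].

Lemma gmulA : associative gmul.
Proof.
move=> f g h; apply/ffunP=> x; rewrite !ffunE.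
under eq_bigr => y _ do rewrite ffunE mulr_sumr.
under [RHS]eq_bigr => y _ do rewrite ffunE mulr_suml.
rewrite [RHS]exchange_big /=; apply: eq_bigr => y _.
rewrite [RHS](reindex_inj (mulgI y)) /=; apply: eq_bigr => z _.
by rewrite mulrA invMg mulKg mulgA.
Qed.

Lemma gmulC : commutative gmul.
Proof.
move=> f g; apply/ffunP=> x; rewrite !ffunE.
rewrite (reindex_inj (inj_comp (mulgI x) (@invg_inj gT))) /=.
apply: eq_bigr => y _.
by rewrite invMg invgK mulgKV mulrC mulgC_abelian.
Qed.

Lemma delta_mulE x f y : gmul (delta x) f y = f (x^-1 * y)%g.
Proof.
rewrite ffunE (bigD1 x) //= ffunE eqxx mul1r big1 ?addr0 // => z /negPf zx.
by rewrite ffunE zx mul0r.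
Qed.

Lemma gmul1 : left_id (delta 1%g) gmul.
Proof. by move=> f; apply/ffunP=> y; rewrite delta_mulE invg1 mul1g. Qed.

Lemma gmulDl : left_distributive gmul +%R.
Proof.
move=> f g h; apply/ffunP=> x; rewrite !ffunE -big_split /=.
by apply: eq_bigr => y _; rewrite ffunE mulrDl.
Qed.

Lemma delta1_neq0 : delta 1%g != 0.
Proof. by apply/eqP=> /ffunP/(_ 1%g); rewrite !ffunE eqxx. Qed.

HB.instance Definition _ := GRing.Zmodule_isComNzRing.Build gring
  gmulA gmulC gmul1 gmulDl delta1_neq0.

Lemma gmulE f g x : (f * g) x = \sum_y f y * g (y^-1 * x)%g.
Proof. by rewrite ffunE. Qed.

Lemma goneE x : (1 : gring) x = (x == 1%g)%:R.
Proof. by rewrite ffunE. Qed.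

Lemma gaddE f g x : (f + g) x = f x + g x.
Proof. by rewrite ffunE. Qed.

Lemma goppE f x : (- f) x = - f x.
Proof. by rewrite ffunE. Qed.

Lemma gmulrnE f n x : (f *+ n) x = f x *+ n.
Proof. by elim: n => [|n IHn]; rewrite ?mulr0n ?ffunE // !mulrS gaddE IHn. Qed.

Lemma gmulrnI n : (0 < n)%N -> injective (fun f => f *+ n).
Proof.
move=> n_gt0 f g /ffunP eq_fg; apply/ffunP=> x.
by apply: (pmulrnI n_gt0); rewrite /= -!gmulrnE eq_fg.
Qed.

(** For bijective [phi] this sends a group element to its preimage under [phi]; pulling back along
    squaring thus extracts square roots. *)
Definition pull (phi : gT -> gT) f : gring := [ffun x => f (phi x)].

Section Pull.
Variable phi : gT -> gT.
Hypotheses (phiM : {morph phi : x y / (x * y)%g}) (phiI : injective phi).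

Lemma pullD : {morph pull phi : f g / f + g}.
Proof. by move=> f g; apply/ffunP=> x; rewrite !ffunE. Qed.

Lemma pull_mulrn n f : pull phi (f *+ n) = pull phi f *+ n.
Proof. by apply/ffunP=> x; rewrite !(ffunE, gmulrnE). Qed.

Lemma pull_morphV x y : phi (x^-1 * y)%g = ((phi x)^-1 * phi y)%g.
Proof. by apply: (mulgI (phi x)); rewrite mulKVg -phiM mulKVg. Qed.

Lemma pullM : {morph pull phi : f g / f * g}.
Proof.
move=> f g; apply/ffunP=> x; rewrite ffunE !gmulE (reindex_inj phiI) /=.
by apply: eq_bigr => y _; rewrite !ffunE pull_morphV.
Qed.

Lemma pull1 : pull phi 1 = 1.
Proof.
have phi1: phi 1%g = 1%g by rewrite -{1}(mulVg 1%g) pull_morphV mulVg.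
by apply/ffunP=> x; rewrite ffunE !goneE -[in LHS]phi1 (inj_eq phiI).
Qed.

Lemma pull_prod (I : Type) (r : seq I) (P : pred I) (F : I -> gring) :
  pull phi (\prod_(i <- r | P i) F i) = \prod_(i <- r | P i) pull phi (F i).
Proof. exact: (big_morph _ pullM pull1). Qed.
End Pull.

Definition ind (S : {set gT}) : gring := [ffun x => (x \in S)%:R].
Definition gsum f : int := \sum_x f x.

Lemma indE (S : {set gT}) x : ind S x = (x \in S)%:R.
Proof. by rewrite ffunE. Qed.

Lemma ind_mulE (S : {set gT}) f x : (ind S * f) x = \sum_(y in S) f (y^-1 * x)%g.
Proof.
rewrite gmulE [RHS]big_mkcond /=; apply: eq_bigr => y _.
by rewrite indE; case: (y \in S); rewrite ?mul1r ?mul0r.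
Qed.

Lemma indT_mulE f x : (ind [set: gT] * f) x = gsum f.
Proof.
rewrite mulrC gmulE; apply: eq_bigr => y _.
by rewrite indE inE mulr1.
Qed.

Lemma gsumM f g : gsum (f * g) = gsum f * gsum g.
Proof.
rewrite /gsum; under eq_bigr => x _ do rewrite gmulE.
rewrite exchange_big /= mulr_suml; apply: eq_bigr => y _.
rewrite -mulr_sumr; congr (_ * _).
by rewrite [RHS](reindex_inj (mulgI y^-1%g)).
Qed.

Lemma gsum_ind (S : {set gT}) : gsum (ind S) = #|S|%:R.
Proof.
rewrite /gsum -sum1_card natr_sum [RHS]big_mkcond /=.
by apply: eq_bigr => x _; rewrite indE; case: (x \in S).
Qed.

(* Multiplication by [#|G| - J], with [J] the sum of all group elements; it
   kills the multiples of [J]. *)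
Definition center f : gring := f *+ #|gT| - ind [set: gT] * f.

Lemma centerE f x : center f x = f x *+ #|gT| - gsum f.
Proof. by rewrite gaddE goppE gmulrnE indT_mulE. Qed.

Lemma centerMl f g : center (f * g) = center f * g.
Proof. by rewrite /center mulrBl mulrnAl mulrA. Qed.

Lemma centerMr f g : center (f * g) = f * center g.
Proof. by rewrite mulrC centerMl mulrC. Qed.

Lemma center_indT : center (ind [set: gT]) = 0.
Proof.
apply/ffunP=> x; rewrite centerE gsum_ind indE inE cardsT ffunE.
by rewrite subrr.
Qed.

Lemma centerD : {morph center : f g / f + g}.
Proof. by move=> f g; rewrite /center mulrnDl mulrDr opprD addrACA. Qed.

Lemma center_mulrn n f : center (f *+ n) = center f *+ n.
Proof. by rewrite /center mulrnAC mulrnAr mulrnBl. Qed.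

End GroupRing.

(** * Divisibility by powers of 2 and the squaring automorphism *)

Section Squaring.
Local Open Scope ring_scope.
Variables (gT : finGroupType) (abG : abelian [set: gT]).
Hypothesis oddG : odd #|gT|.
Local Notation gring := (gring_of abG).
Implicit Types f g h w z : gring.

Definition gdvd (n : nat) f := exists u : gring, f = u *+ n.

Lemma gdvdMr n f g : gdvd n f -> gdvd n (f * g).
Proof. by case=> u ->; exists (u * g); rewrite mulrnAl. Qed.

Lemma gdvd_coef n f x : gdvd n f -> (n%:Z %| f x)%Z.
Proof. by case=> u ->; rewrite gmulrnE -mulr_natr natz dvdz_mull. Qed.

Definition sqg (x : gT) := (x ^+ 2)%g.
Local Notation rho := (@pull gT abG sqg).

Lemma sqgM : {morph sqg : x y / (x * y)%g}.
Proof. by move=> x y; apply: expgMn; apply: mulgC_abelian. Qed.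

Lemma expg_card_type (x : gT) : (x ^+ #|gT| = 1)%g.
Proof. by rewrite -cardsT; apply: (@expg_cardG _ [set: gT]%G); rewrite inE. Qed.

Lemma sqgI : injective sqg.
Proof.
move=> x y; rewrite /sqg => eq_xy.
have sqr_expK (z : gT) : ((z ^+ 2) ^+ (#|gT|.+1./2) = z)%g.
  rewrite -expgM mulnC muln2 halfK /= oddG /= subn0.
  by rewrite expgS expg_card_type mulg1.
by rewrite -(sqr_expK x) eq_xy.
Qed.

Let rhoM : {morph rho : f g / f * g} := pullM sqgM sqgI.

Lemma gring_sum_delta f : f = \sum_x delta abG x *~ f x.
Proof.
have mulrzE h (n : int) x : (h *~ n) x = h x *~ n.
  by case: n => n; rewrite ?NegzE ?mulrNz ?goppE -!pmulrn gmulrnE.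
have sumE (F : gT -> gring) x : (\sum_y F y) x = \sum_y F y x.
  by elim/big_rec2: _ => [|y a b _ <-]; rewrite ffunE.
apply/ffunP=> y; rewrite sumE (bigD1 y) //= big1 => [|x /negPf xy].
  by rewrite mulrzE ffunE eqxx addr0 intz.
by rewrite mulrzE ffunE eq_sym xy mul0rz.
Qed.

(** Modulo 2, squaring is additive and sends a group element [x] to [x^2], which [rho] takes back to
    [x]. *)
Lemma frobenius_mod2 f : exists u : gring, rho (f * f) = f + u *+ 2.
Proof.
pose P f := exists u : gring, rho (f * f) = f + u *+ 2.
have PD f1 f2 : P f1 -> P f2 -> P (f1 + f2).
  move=> [u1 E1] [u2 E2]; exists (u1 + u2 + rho (f1 * f2)).
  have -> : (f1 + f2) * (f1 + f2) = f1 * f1 + f2 * f2 + (f1 * f2) *+ 2 by ring.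
  rewrite 2!pullD E1 E2 pull_mulrn; ring.
have P0 : P 0 by exists 0; rewrite mulr0 mul0rn addr0; apply/ffunP=> x; rewrite !ffunE.
have PN f1 : P f1 -> P (- f1).
  move=> [u E]; exists (u + f1); rewrite mulrNN E; ring.
have Pdelta x : P (delta abG x).
  exists 0; rewrite mul0rn addr0; apply/ffunP=> y.
  rewrite ffunE delta_mulE !ffunE; congr (nat_of_bool _)%:R.
  by rewrite -(inj_eq (mulgI x)) mulKVg -[RHS](inj_eq sqgI).
have PZ x (n : int) : P (delta abG x *~ n).
  have Pn m : P (delta abG x *+ m).
    by elim: m => [|m IHm]; rewrite ?mulr0n // mulrS; apply: PD.
  by case: n => n; rewrite ?NegzE ?mulrNz -pmulrn //; apply: PN.
rewrite [f]gring_sum_delta; apply: (big_ind P) => // x _; exact: PZ.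
Qed.

(** Applying [rho] to the square recovers [f] modulo 2; so the group ring modulo 2 has no nonzero
    nilpotents. *)
Lemma gdvd2_sqr f : gdvd 2 (f * f) -> gdvd 2 f.
Proof.
move=> [u E]; have [w F] := frobenius_mod2 f.
exists (rho u - w); rewrite mulrnBl -pull_mulrn -E F.
by rewrite addrK.
Qed.

(** Multiply by [rho w]: modulo 2, [rho w * rho w = rho (w * w)] is [w]. *)
Lemma gdvd2_mul_rho f w : gdvd 2 (f * rho w) -> gdvd 2 (f * w).
Proof.
move=> dvd_fw; have [u E] := frobenius_mod2 w.
have [t F] := gdvdMr (rho w) dvd_fw.
exists (t - f * u); rewrite mulrnBl -F -mulrA -rhoM E mulrDr mulrnAr.
by rewrite addrK.
Qed.

(** Each induction step removes one factor. With [w] the shorter product, [z * rho w] is even; hence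
    so is [z * w], then [w * w] because [z] divides [w], and finally [w]. *)
Lemma gdvd2_prod_rho n z :
  (0 < n)%N -> gdvd 2 (\prod_(i < n) iter i rho z) -> gdvd 2 z.
Proof.
case: n => // n _; elim: n => [|n IHn]; first by rewrite big_ord1.
rewrite big_ord_recl /= => dvd_z; apply: IHn.
set w := \prod_(i < n.+1) _ in dvd_z *.
have {}dvd_z: gdvd 2 (z * rho w).
  rewrite /w pull_prod //; first exact: sqgM.
  exact: sqgI.
have [dvd_zw wE] : gdvd 2 (z * w) /\ exists t, w = z * t.
  split; first exact: gdvd2_mul_rho.
  by rewrite /w big_ord_recl /=; eexists.
case: wE dvd_zw => t wE dvd_zw; apply: gdvd2_sqr.
by rewrite {2}wE mulrA [w * z]mulrC; apply: gdvdMr.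
Qed.

(** The iterates of [rho] are the pullbacks along the powers [2 ^ d], and Euler's theorem gives an
    exponent that is 1 modulo the group order. *)
Lemma iter_rho_period : exists2 d, (0 < d)%N & forall f, iter d rho f = f.
Proof.
have rhoE d f x : (iter d rho f) x = f (x ^+ (2 ^ d))%g.
  elim: d x => [|d IHd] x; first by rewrite expg1.
  by rewrite iterS ffunE IHd -expgM expnS.
have G_gt0 : (0 < #|gT|)%N by apply/card_gt0P; exists 1%g.
exists (totient #|gT|) => [|f]; first by rewrite totient_gt0.
apply/ffunP=> x; rewrite rhoE; congr (f _).
have := Euler_exp_totient (a := 2) (n := #|gT|).
rewrite coprime2n oddG => /(_ isT) E.
have expg_modG m : (x ^+ (m %% #|gT|) = x ^+ m)%g.
  rewrite [in RHS](divn_eq m #|gT|) expgD mulnC expgM expg_card_type.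
  by rewrite expg1n mul1g.
by rewrite -expg_modG E expg_modG expg1.
Qed.

(* With [d] the order of [rho], the quotient [z] of [rho f * g] by [2^m] has the
   same product over its [rho]-orbit as [f * g / 2^m], and this product is
   divisible by [2^d].  As the group ring is reduced modulo 2, [z] is even. *)
Lemma gdvd_mul_rho m f g : gdvd (2 ^ m) (f * g) -> gdvd (2 ^ m) (rho f * g).
Proof.
elim: m => [|m IHm]; first by exists (rho f * g).
case=> w fgE; have [|z rfgE] := IHm.
  by exists (w *+ 2); rewrite fgE -mulrnA expnS.
suff [u zE] : gdvd 2 z by exists u; rewrite rfgE zE -mulrnA expnS.
have [d d_gt0 rho_d] := iter_rho_period.
have iterM i : {morph iter i rho : h1 h2 / h1 * h2}.
  by elim: i => // i IHi h1 h2; rewrite !iterS IHi rhoM.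
have iter_mulrn n i h : iter i rho (h *+ n) = iter i rho h *+ n.
  by elim: i => //= i ->; rewrite pull_mulrn.
have prod_mulrn n (F : 'I_d -> gring) :
    \prod_i (F i *+ n) = (\prod_i F i) *+ n ^ d.
  by rewrite prodrMn_const card_ord.
(* [rho] permutes the factors cyclically. *)
have shift h : \prod_(i < d) iter i rho (rho h) = \prod_(i < d) iter i rho h.
  case: d d_gt0 rho_d {iterM iter_mulrn prod_mulrn} => // d _ rho_d.
  rewrite big_ord_recr [RHS]big_ord_recl /= -iterSr rho_d mulrC.
  by congr (_ * _); apply: eq_bigr => i _; rewrite -iterSr.
have prodM h1 h2 : \prod_(i < d) iter i rho (h1 * h2) =
    (\prod_(i < d) iter i rho h1) * \prod_(i < d) iter i rho h2.
  by rewrite -big_split /=; apply: eq_bigr => i _; rewrite iterM.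
apply: (gdvd2_prod_rho d_gt0); exists ((\prod_(i < d) iter i rho w) *+ 2 ^ d.-1).
(* The group ring is torsion-free, so both sides may be multiplied by [(2 ^ m) ^ d]; they then
   become orbit products of [rho f * g] and of [w *+ 2 ^ m.+1]. *)
apply: (@gmulrnI _ abG ((2 ^ m) ^ d)); first by rewrite !expn_gt0.
rewrite /= -prod_mulrn; under eq_bigr => i _ do rewrite -iter_mulrn -rfgE.
rewrite prodM shift -prodM fgE.
rewrite (eq_bigr (fun i : 'I_d => iter i rho w *+ 2 ^ m.+1)) => [|i _]; last first.
  exact: iter_mulrn.
rewrite prod_mulrn -!mulrnA; congr (_ *+ _).
by rewrite mulnA -expnSr prednK // -expnMn -expnS.
Qed.

(** If [f] is [2 ^ m] times [z], then [z * z] is divisible by 4, so [z] is even by [gdvd2_sqr]. *)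
Lemma gdvd_sqr m f : gdvd (2 ^ (2 * m)) (f * f) -> gdvd (2 ^ m) f.
Proof.
elim: m => [|m IHm]; first by exists f.
case=> w ffE; have [|z fE] := IHm.
  exists (w *+ 4); rewrite ffE -mulrnA; congr (_ *+ _).
  by rewrite mulnS expnD.
suff [u zE] : gdvd 2 z by exists u; rewrite fE zE -mulrnA expnS.
apply: gdvd2_sqr; exists (w *+ 2).
apply: (@gmulrnI _ abG (2 ^ m * 2 ^ m)); first by rewrite muln_gt0 !expn_gt0.
rewrite /= [LHS]mulrnA -mulrnAl -mulrnAr -fE ffE -!mulrnA.
by congr (_ *+ _); rewrite mulnS mul2n -addnn !expnD [RHS]mulnA.
Qed.

End Squaring.

(** * Difference sets as group ring equations *)

Section DifferenceSets.
Local Open Scope ring_scope.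
Variables (gT : finGroupType) (abG : abelian [set: gT]) (D : {set gT}).
Variables (v k lam n : nat).
Hypotheses (dsD : difference_set [set: gT] D v k lam) (k_eq : k = (n + lam)%N).
Local Notation gring := (gring_of abG).
Local Notation ind := (@ind gT abG).
Local Notation inv := (@pull gT abG invg).
Local Notation J := (ind [set: gT]).

Lemma inv_morph : {morph @invg gT : x y / (x * y)%g}.
Proof. by move=> x y; rewrite invMg (mulgC_abelian abG). Qed.

Lemma gsum_pull phi (f : gring) : injective phi -> gsum (pull phi f) = gsum f.
Proof.
move=> phiI; rewrite /gsum [RHS](reindex_inj phiI) /=.
by apply: eq_bigr => x _; rewrite ffunE.
Qed.

Lemma ind_mul_invE (S T : {set gT}) x :
  (ind S * inv (ind T)) x = #|[set y in S | (x^-1 * y)%g \in T]|%:R.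
Proof.
rewrite ind_mulE -sum1_card natr_sum.
under [RHS]eq_bigl => y do rewrite inE.
rewrite [RHS]big_mkcondr /=; apply: eq_bigr => y _.
by rewrite !ffunE invMg invgK; case: (_ \in T).
Qed.

Lemma card_type_ds : #|gT| = v.
Proof. by case: dsD => _ <- _ _; rewrite cardsT. Qed.

Lemma card_ds : #|D| = k.
Proof. by case: dsD. Qed.

Lemma card_ds_pairs x :
  #|[set p in setX D D | (p.1 * p.2^-1 == x)%g]| =
  #|[set y in D | (x^-1 * y)%g \in D]|.
Proof.
rewrite -[RHS](card_imset _ (f := fun y => (y, x^-1 * y)%g)); last by move=> y z [].
apply: eq_card => -[a b]; rewrite !inE /=; apply/andP/imsetP.
  case=> /andP[aD bD] /eqP <-; exists a; rewrite ?inE invMg invgK mulgKV ?aD //.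
by case=> y; rewrite inE => /andP[yD xyD] [-> ->]; rewrite yD xyD invMg invgK mulKVg.
Qed.

Lemma ds_gring : ind D * inv (ind D) = 1 *+ n + J *+ lam.
Proof.
case: dsD => _ _ cardD reps; apply/ffunP=> x.
rewrite ind_mul_invE gaddE !gmulrnE goneE indE inE.
have [->|x1] := eqVneq x 1%g; last first.
  by rewrite -card_ds_pairs reps ?inE // mul0rn add0r.
rewrite -mulrnDr -k_eq -cardD; congr (_%:R); apply: eq_card => y.
by rewrite !inE invg1 mul1g andbb.
Qed.

(** Compare the coefficient sums of the two sides of [ds_gring]. *)
Lemma ds_count : (k * k = n + lam * v)%N.
Proof.
have := congr1 (@gsum gT abG) ds_gring.
rewrite gsumM gsum_pull ?gsum_ind ?card_ds; last exact: invg_inj.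
have -> : gsum (1 *+ n + J *+ lam) = (n + lam * v)%:R.
  rewrite /gsum; under eq_bigr => x _ do
    rewrite gaddE !gmulrnE goneE indE inE.
  rewrite big_split /= (bigD1 1%g) //= eqxx big1 ?addr0 => [|x /negPf ->]; last first.
    by rewrite mul0rn.
  by rewrite sumr_const -mulrnA -card_type_ds natrD mul1n -mulrnA.
by rewrite -natrM => /eqP; rewrite eqr_nat => /eqP.
Qed.

End DifferenceSets.

(** * The multiplier 2 *)

Section Multiplier.
Local Open Scope ring_scope.
Variables (gT : finGroupType) (abG : abelian [set: gT]) (D : {set gT}).
Variables (v k lam m : nat).
Hypotheses (dsD : difference_set [set: gT] D v k lam).
Hypotheses (k_eq : k = (2 ^ m + lam)%N) (odd_v : odd v).
Local Notation ind := (@ind gT abG).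
Local Notation inv := (@pull gT abG invg).

Let oddG : odd #|gT|. Proof. by rewrite (card_type_ds dsD). Qed.

(* The coefficients of [rho D * D^-1] are congruent to [lam] modulo
   [2 ^ m = k - lam] and their mean value exceeds [lam], so one of them is at
   least [k]. *)
Lemma multiplier_translate :
  exists g : gT, forall x, (sqg x \in D) = ((g^-1 * x)%g \in D).
Proof.
pose F g := #|[set y in @sqg gT @^-1: D | (g^-1 * y)%g \in D]|.
have pull_ind : pull (@sqg gT) (ind D) = ind (@sqg gT @^-1: D).
  by apply/ffunP=> x; rewrite !ffunE inE.
have FE g : (pull (@sqg gT) (ind D) * inv (ind D)) g = (F g)%:R.
  by rewrite pull_ind ind_mul_invE.
have card_pre : #|@sqg gT @^-1: D| = k.
  by rewrite on_card_preimset ?(card_ds dsD) //; apply: onW_bij; apply: injF_bij; apply: sqgI.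
have sumF : (\sum_g F g = k * k)%N.
  apply/eqP; rewrite -(eqr_nat int) natr_sum natrM -{1}card_pre -(card_ds dsD).
  rewrite -!(gsum_ind abG) -pull_ind -(gsum_pull (phi := invg) (ind D)); last exact: invg_inj.
  by rewrite -gsumM /gsum; apply/eqP/eq_bigr => g _; rewrite FE.
have F_mod g : (F g = lam %[mod 2 ^ m])%N.
  (* Centering can be moved into the second factor, so [gdvd_mul_rho] reduces the claim to the
     centered [ds_gring], where the multiple of [J] has vanished. *)
  have : gdvd (2 ^ m) (center (pull (@sqg gT) (ind D) * inv (ind D))).
    rewrite centerMr; apply: (gdvd_mul_rho oddG); rewrite -centerMr (ds_gring abG dsD k_eq).
    exists (center 1); rewrite centerD [center (_ *+ lam)]center_mulrn center_indT.
    by rewrite mul0rn addr0 center_mulrn.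
  move/(gdvd_coef g); rewrite centerE gsumM.
  rewrite (gsum_pull (phi := @sqg gT)); last exact: sqgI.
  rewrite gsum_pull ?gsum_ind ?(card_ds dsD); last exact: invg_inj.
  rewrite FE (card_type_ds dsD) -natrM (ds_count abG dsD k_eq) -(mulr_natr _ v).
  rewrite natrD natrM !natz.
  (* The centered coefficient is [F g * v - k * k], with [k * k] expanded by [ds_count]; the odd
     factor [v] can then be cancelled modulo [2 ^ m]. *)
  have -> : (F g)%:Z * v%:Z - ((2 ^ m)%:Z + lam%:Z * v%:Z) =
            ((F g)%:Z - lam%:Z) * v%:Z - (2 ^ m)%:Z by ring.
  rewrite rpredBr ?dvdzz // Gauss_dvdzl; last by rewrite coprimezE coprimeXl ?coprime2n.
  by rewrite -eqz_mod_dvd !modz_nat => /eqP[].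
have [g Fg] : exists g, (lam < F g)%N.
  apply/existsP; apply: contraT; rewrite negb_exists => /forallP F_le.
  have : (\sum_g F g <= lam * v)%N.
    rewrite -(card_type_ds dsD) mulnC -sum_nat_const; apply: leq_sum => g _.
    by rewrite leqNgt F_le.
  by rewrite sumF (ds_count abG dsD k_eq) leqNgt -[ltnLHS]add0n ltn_add2r expn_gt0.
have F_ge : (k <= F g)%N.
  have : (2 ^ m %| F g - lam)%N by rewrite -eqn_mod_dvd ?(ltnW Fg) // F_mod.
  by move/dvdn_leq; rewrite subn_gt0 => /(_ Fg); rewrite (leq_subRL _ (ltnW Fg)) addnC k_eq.
exists g => x.
(* An intersection of two [k]-sets with at least [k] elements equals both of them. *)
have S1 : [set y in @sqg gT @^-1: D | (g^-1 * y)%g \in D] = @sqg gT @^-1: D.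
  apply/eqP; rewrite eqEcard card_pre F_ge andbT.
  by apply/subsetP=> y; rewrite inE => /andP[].
have S2 : [set y in @sqg gT @^-1: D | (g^-1 * y)%g \in D] = [set y | (g^-1 * y)%g \in D].
  apply/eqP; rewrite eqEcard; apply/andP; split.
    by apply/subsetP=> y; rewrite !inE => /andP[].
  apply: leq_trans F_ge; rewrite -(card_ds dsD).
  have -> : [set y | (g^-1 * y)%g \in D] = mulg g^-1%g @^-1: D.
    by apply/setP=> y; rewrite !inE.
  rewrite on_card_preimset //; apply: onW_bij; apply: injF_bij; apply: mulgI.
by have /setP/(_ x) := etrans (esym S1) S2; rewrite !inE.
Qed.

Hypothesis normD : normalized D.

(** The elements whose square is in [D] form the translate [g D]. By normalization their product is
    [g ^+ k], and its square is the product over [D], that is 1. So the order of [g] divides both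
    [2 * k] and [v]. *)
Lemma multiplier2 x : (sqg x \in D) = (x \in D).
Proof.
have [g multE] := multiplier_translate.
(* Packs the group law as a commutative law, so that products over [D] can be reindexed. *)
pose mulC : Monoid.com_law 1%g :=
  HB.pack (@mulg gT) (SemiGroup.isCommutativeLaw.Build gT mulg (mulgC_abelian abG)).
have reindexD (phi : gT -> gT) : injective phi ->
    (\prod_(y in D) y = \prod_(y | phi y \in D) phi y)%g.
  by move=> phiI; apply: (@reindex_inj _ mulC 1%g).
have prodM (P : pred gT) (F1 F2 : gT -> gT) :
    (\prod_(y | P y) (F1 y * F2 y) =
      (\prod_(y | P y) F1 y) * \prod_(y | P y) F2 y)%g.
  exact: (@big_split _ 1%g mulC).
have prod_pre : (\prod_(y | sqg y \in D) y = g ^+ k)%g.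
  under eq_bigl => y do rewrite multE.
  rewrite (@reindex_inj _ mulC 1%g _ _ _ _ (mulgI g)) /=.
  under eq_bigl => y do rewrite mulKg.
  by rewrite prodM prodg_const (card_ds dsD) normD mulg1.
have gk1 : (g ^+ (2 * k) = 1)%g.
  by rewrite mulnC expgM -prod_pre expg2 -prodM -(reindexD _ (sqgI oddG)) normD.
suff g1 : g = 1%g by rewrite multE g1 invg1 mul1g.
apply/eqP; rewrite -order_eq1 -dvdn1.
(* A common divisor of [k * k = 2 ^ m + lam * v] and the odd number [v] divides [2 ^ m]. *)
have co_kv : coprime (2 * k) v.
  rewrite coprimeMl coprime2n odd_v /=.
  rewrite -(@coprime_pexpl 2) // -mulnn (ds_count abG dsD k_eq).
  by rewrite /coprime gcdnC addnC gcdnMDl -/(coprime _ _) coprimeXr // coprimen2.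
rewrite -(eqP co_kv) dvdn_gcd order_dvdn gk1 eqxx /= -(card_type_ds dsD).
by rewrite order_dvdn expg_card_type.
Qed.
End Multiplier.

(** * Intersections of a difference set with the cosets of a subgroup *)

Section CosetCounts.
Local Open Scope ring_scope.
Variables (gT : finGroupType) (abG : abelian [set: gT]) (D : {set gT}).
Variables (v k lam m : nat) (N : {group gT}).
Hypotheses (dsD : difference_set [set: gT] D v k lam).
Hypotheses (k_eq : k = (2 ^ (2 * m) + lam)%N) (odd_v : odd v).
Local Notation ind := (@ind gT abG).
Local Notation inv := (@pull gT abG invg).
Local Notation J := (ind [set: gT]).

Definition coset_count (S : {set gT}) (A : {set gT}) x := #|S :&: (x *: A)%g|.

Let oddG : odd #|gT|. Proof. by rewrite (card_type_ds dsD). Qed.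

(** The image of [D] in the group ring of the quotient by [N], kept as a function on the whole group
    that is constant on cosets. *)
Let f := ind D * ind N.

Lemma inv_ind_group : inv (ind N) = ind N.
Proof. by apply/ffunP=> x; rewrite !ffunE groupV. Qed.

Lemma ind_groupM : ind N * ind N = ind N *+ #|N|.
Proof.
apply/ffunP=> x; rewrite -{2}inv_ind_group ind_mul_invE gmulrnE indE.
rewrite -mulrnA; case: (boolP (x \in N)) => xN.
  rewrite mul1n; congr (_%:R); apply: eq_card => y; rewrite !inE.
  by case yN: (y \in N) => //=; rewrite groupMl ?groupV // yN.
rewrite mul0n; congr (_%:R); apply: eq_card0 => y; rewrite !inE.
by apply/negP=> /andP[yN]; rewrite groupMr // groupV (negPf xN).
Qed.

Lemma coset_countE x : f x = (coset_count D N x)%:R.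
Proof.
rewrite /f -inv_ind_group ind_mul_invE; congr (_%:R); apply: eq_card => y.
by rewrite !inE mem_lcoset.
Qed.

Lemma f_inv_f : f * inv f = ind N *+ (2 ^ (2 * m) * #|N|) + J *+ (lam * (#|N| * #|N|)).
Proof.
have -> : inv f = inv (ind D) * ind N.
  rewrite /f (pullM (inv_morph abG) (@invg_inj gT)); congr (_ * _).
  exact: inv_ind_group.
rewrite /f mulrACA (ds_gring abG dsD k_eq) ind_groupM.
rewrite mulrDl !mulrnAl mul1r mulrnAr -!mulrnA; congr (_ + _).
  by congr (_ *+ _); rewrite mulnC.
have -> : J * ind N = J *+ #|N|.
  by apply/ffunP=> x; rewrite indT_mulE gsum_ind gmulrnE indE inE.
by rewrite -!mulrnA; congr (_ *+ _); rewrite mulnA mulnC.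
Qed.

Lemma sum_coset_count : (\sum_x coset_count D N x = k * #|N|)%N.
Proof.
apply/eqP; rewrite -(eqr_nat int) natr_sum natrM -(card_ds dsD) -!(gsum_ind abG).
by rewrite -gsumM; apply/eqP/eq_bigr => x _; rewrite coset_countE.
Qed.

(** This is the coefficient of [f * inv f] at the identity. The sum runs over group elements, so
    each coset is counted [#|N|] times. *)
Lemma sum_sqr_coset_count :
  (\sum_x coset_count D N x ^ 2 = #|N| * (2 ^ (2 * m) + lam * #|N|))%N.
Proof.
have fE : (f * inv f) 1%g = (\sum_x coset_count D N x ^ 2)%:R.
  rewrite gmulE natr_sum; apply: eq_bigr => y _.
  by rewrite [inv f _]ffunE mulg1 invgK coset_countE natrX expr2.
apply/eqP; rewrite -(eqr_nat int) -fE f_inv_f gaddE !gmulrnE !indE group1 inE.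
by rewrite -mulrnDr; apply/eqP; congr (_%:R); rewrite mulnDr mulnC (mulnCA lam).
Qed.

Hypothesis sym : forall x, coset_count D N x^-1%g = coset_count D N x.

(** Symmetry turns [f_inv_f] into a formula for [f * f]. Centering removes [J], and [gdvd_sqr] gives
    [center f] divisible by [2 ^ m]; its coefficients are the differences of the two sides. *)
Lemma coset_count_mod x : (coset_count D N x * v = k * #|N| %[mod 2 ^ m])%N.
Proof.
have inv_f : inv f = f.
  by apply/ffunP=> y; rewrite ffunE !coset_countE sym.
have cff : center (f * f) = center (ind N) *+ #|N| *+ 2 ^ (2 * m).
  rewrite -{2}inv_f f_inv_f centerD [X in _ + X]center_mulrn center_indT.
  by rewrite mul0rn addr0 center_mulrn -mulrnA mulnC.
have /(gdvd_sqr oddG)/(gdvd_coef x) : gdvd (2 ^ (2 * m)) (center f * center f).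
  rewrite -centerMr -centerMl cff center_mulrn.
  by exists (center (center (ind N) *+ #|N|)).
rewrite centerE gsumM !gsum_ind (card_ds dsD) (card_type_ds dsD) coset_countE.
rewrite -natrM -mulrnA !natz -eqz_mod_dvd !modz_nat => /eqP[].
by [].
Qed.

End CosetCounts.

(** * Involutions, symmetric coset counts and Hall subgroups *)

Lemma odd_involution_fixed (T : finType) (S : {set T}) (h : T -> T) a :
    {in S, forall x, h x \in S} -> {in S, involutive h} ->
    {in S, forall x, h x = x -> x = a} -> odd #|S| -> a \in S.
Proof.
have [n] := ubnP #|S|; elim: n S => // n IHn S ltS hS hK fixS oddS.
have /set0Pn[x xS] : S != set0 by apply: contraTneq oddS => ->; rewrite cards0.
have [/(fixS x xS) <- //|hx] := eqVneq (h x) x.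
have hxS : h x \in S :\ x by rewrite !inE hx hS.
have cardS : #|S| = #|S :\ x :\ h x|.+2.
  by rewrite (cardsD1 x) xS (cardsD1 (h x)) hxS.
suff : a \in S :\ x :\ h x by rewrite !inE => /and3P[].
apply: IHn; last by rewrite cardS /= negbK in oddS.
- by rewrite cardS ltnS in ltS; rewrite (leq_trans _ ltS).
- move=> y; rewrite !inE => /and3P[y1 y2 yS]; rewrite hS // andbT.
  apply/andP; split; last by apply: contraNneq y1 => <-; rewrite hK.
  by apply: contraNneq y2 => E; rewrite -(hK y yS) E hK.
- by move=> y; rewrite !inE => /and3P[_ _]; apply: hK.
- by move=> y; rewrite !inE => /and3P[_ _]; apply: fixS.
Qed.

Section Symmetry.
Variables (gT : finGroupType) (abG : abelian [set: gT]).
Implicit Types (x y : gT) (S : {set gT}).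

(** The power [r] acts as inversion modulo [N], so it maps the part of [S] in [x N] injectively into
    the part in the inverse coset. Applying this to [x^-1] as well gives equality. *)
Lemma coset_count_inv S (N : {group gT}) (r : nat) :
    {in S, forall y, (y ^+ r)%g \in S} -> coprime r #|gT| ->
    (forall x, (x ^+ r * x)%g \in N) ->
  forall x, coset_count S N x^-1%g = coset_count S N x.
Proof.
move=> S_r co_r N_r.
have le_count x : coset_count S N x <= coset_count S N x^-1%g.
  rewrite /coset_count -(card_in_imset (f := fun y => (y ^+ r)%g)); last first.
    have co : coprime #|[set: gT]%G| r by rewrite cardsT coprime_sym.
    by move=> y z _ _; apply: (can_in_inj (expgK co)); rewrite inE.
  apply: subset_leq_card; apply/subsetP=> _ /imsetP[y /setIP[yS yN] ->].
  rewrite inE S_r //= mem_lcoset invgK.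
  have -> : (x * y ^+ r = (y ^+ r * y) * (y^-1 * x))%g.
    by rewrite -mulgA mulKVg (mulgC_abelian abG).
  rewrite groupMr ?N_r // -groupV invMg invgK.
  by rewrite -mem_lcoset.
by move=> x; apply/eqP; rewrite eqn_leq le_count -{2}(invgK x) le_count.
Qed.

Lemma abelian_Hall_subgroup (n r : nat) :
    #|gT| = (n * r)%N -> coprime n r ->
  exists A : {group gT}, #|A| = n /\ forall x, (x \in A) = (x ^+ n == 1)%g.
Proof.
move=> cardG co_nr.
have G_gt0 : 0 < n * r by rewrite -cardG; apply/card_gt0P; exists 1%g.
have [n_gt0 r_gt0] : 0 < n /\ 0 < r by apply/andP; rewrite -muln_gt0.
have hallA := nilpotent_pcore_Hall \pi(n) (abelian_nil abG).
have cardA : #|'O_\pi(n)([set: gT])%G| = n.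
  rewrite (card_Hall hallA) cardsT cardG partnM // part_pnat_id ?pnat_pi //.
  by rewrite part_p'nat ?muln1 // -coprime_pi'.
exists 'O_\pi(n)([set: gT])%G; split=> // x; apply/idP/eqP=> [xA | xn1].
  by rewrite -(expg_cardG xA) cardA.
rewrite (mem_normal_Hall hallA) ?pcore_normal ?inE //.
by apply: pnat_dvd (pnat_pi n_gt0); rewrite order_dvdn xn1.
Qed.
End Symmetry.

(** The Singer (15,7,3)-difference set in the integers modulo 15: the union of the orbits {0},
    {1,2,4,8} and {5,10} of doubling. *)
Definition singer_exponents : seq nat := [:: 0; 1; 2; 4; 5; 8; 10].

(** * The line [A], the ovoid [B] and an element of order 15 *)

Section OrderFifteen.
Variables (gT : finGroupType) (abG : abelian [set: gT]) (D : {set gT}) (s q : nat).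
Local Notation v := ((q + 1) * (q ^ 2 + 1)).
Local Notation k := (q ^ 2 + q + 1).
Hypotheses (odd_s : odd s) (qE : q = 2 ^ s) (normD : normalized D).
Hypothesis dsD : difference_set [set: gT] D v k (q + 1).

Let q_gt0 : 0 < q. Proof. by rewrite qE expn_gt0. Qed.

Let q_gt1 : 1 < q.
Proof. by rewrite qE -{1}(expn0 2) ltn_exp2l // lt0n; case: s odd_s. Qed.

Let odd_q : odd q = false.
Proof. by rewrite qE oddX /=; case: s odd_s. Qed.

Let odd_v : odd v. Proof. by rewrite oddM !oddD oddX odd_q. Qed.

Let cardG : #|gT| = v. Proof. exact: card_type_ds dsD. Qed.

Let oddG : odd #|gT|. Proof. by rewrite cardG. Qed.

Let k_eq : k = 2 ^ (2 * s) + (q + 1).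
Proof. by rewrite mulnC expnM qE addnA. Qed.

Lemma coprime_line_ovoid : coprime (q + 1) (q ^ 2 + 1).
Proof.
have -> : q ^ 2 + 1 = (q - 1) * (q + 1) + 2.
  case: q q_gt0 => // r _; rewrite subn1 /=; ring.
by rewrite /coprime gcdnMDl -/(coprime _ 2) coprimen2 oddD odd_q.
Qed.

Let coAB := coprime_line_ovoid.

Lemma ds_pow2 i x : x \in D -> (x ^+ (2 ^ i))%g \in D.
Proof.
move=> xD; elim: i => [|i IHi]; first by rewrite expg1.
by rewrite expnSr expgM (multiplier2 abG dsD k_eq odd_v normD).
Qed.

Lemma coset_count_mod1 (N : {group gT}) :
    (forall x, coset_count D N x^-1%g = coset_count D N x) ->
    #|N| = 1 %[mod q] ->
  forall x, coset_count D N x = 1 %[mod q].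
Proof.
move=> symN N1 x.
have := coset_count_mod abG dsD k_eq odd_v symN x; rewrite -qE.
have -> : v = (q ^ 2 + q + 1) * q + 1 by ring.
have -> : k = (q + 1) * q + 1 by ring.
rewrite -modnMm modnMDl modnMm muln1 => ->.
by rewrite -modnMm modnMDl N1 modnMm muln1.
Qed.

Variables A B : {group gT}.
Hypotheses (cardA : #|A| = q + 1) (memA : forall x, (x \in A) = (x ^+ (q + 1) == 1)%g).
Hypotheses (cardB : #|B| = q ^ 2 + 1)
  (memB : forall x, (x \in B) = (x ^+ (q ^ 2 + 1) == 1)%g).

Let exp_v (x : gT) : (x ^+ v = 1)%g.
Proof. by rewrite -cardG expg_card_type. Qed.

Let co2 i : coprime (2 ^ i) #|gT|.
Proof. by rewrite coprimeXl // coprime2n. Qed.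

(** The inverting exponent is [q ^ 2]: the power [q ^ 2 + 1] of any element lies in [A], since its
    power [q + 1] is 1. For [B] the exponent is [q]. *)
Let symA x : coset_count D A x^-1%g = coset_count D A x.
Proof.
apply: (coset_count_inv abG (r := 2 ^ (2 * s))) => [y|//|y]; first exact: ds_pow2.
by rewrite memA -expgSr -addn1 -expgM mulnC (mulnC 2) expnM -qE exp_v.
Qed.

Let symB x : coset_count D B x^-1%g = coset_count D B x.
Proof.
apply: (coset_count_inv abG (r := 2 ^ s)) => [y|//|y]; first exact: ds_pow2.
by rewrite memB -expgSr -addn1 -expgM -qE exp_v.
Qed.

Let cA_mod x : coset_count D A x = 1 %[mod q].
Proof. by apply: coset_count_mod1; rewrite // cardA -modnDml modnn. Qed.

Let cB_mod x : coset_count D B x = 1 %[mod q].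
Proof.
by apply: coset_count_mod1; rewrite // cardB -modnDml expnS expn1 modnMl.
Qed.

(** The power [q ^ 2] fixes [A] pointwise and inverts [B], so for [a] in [A] it is an involution of
    the coset [a B] whose only fixed point is [a]. It preserves [D :&: a B], whose size is 1 modulo
    the even number [q], hence odd. *)
Lemma line_subset : A \subset D.
Proof.
apply/subsetP=> a aA.
have expA (x : gT) : x \in A -> (x ^+ (q ^ 2) = x)%g.
  rewrite memA => /eqP x1; have -> : q ^ 2 = (q + 1) * (q - 1) + 1.
    case: q q_gt0 => // r _; rewrite subn1 /=; ring.
  by rewrite expgD expgM x1 expg1n mul1g.
have q2E : q ^ 2 = 2 ^ (2 * s) by rewrite mulnC expnM qE.
suff : a \in D :&: (a *: B)%g by case/setIP.
apply: (@odd_involution_fixed _ _ (fun x => x ^+ (q ^ 2))%g) => [x|x|x|].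
- case/setIP=> xD; rewrite mem_lcoset => xB; rewrite inE q2E ds_pow2 //= -q2E.
  rewrite mem_lcoset -[(a^-1)%g]expA ?groupV // -expgMn; last exact: mulgC_abelian.
  exact: groupX.
- move=> _ /=; rewrite -expgM -expnD.
  have -> : q ^ (2 + 2) = v * (q - 1) + 1.
    case: q q_gt0 => // r _; rewrite subn1 /=; ring.
  by rewrite expgD expgM exp_v expg1n mul1g.
- case/setIP=> _; rewrite mem_lcoset memB => /eqP xB xq.
  apply/esym/eqP; rewrite eq_mulVg1; apply/eqP/(sqgI oddG).
  rewrite /sqg expg1n expgS expg1 -[RHS]xB expgD expg1; congr (_ * _)%g.
  rewrite expgMn; last exact: mulgC_abelian.
  by rewrite xq expA ?groupV.
rewrite -/(coset_count D B a) (divn_eq (coset_count D B a) q).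
by rewrite oddD oddM odd_q andbF cB_mod modn_small.
Qed.

(** Counts are positive, being 1 modulo [q]. Elements of [A] contribute [(q + 1) ^ 2] to the total
    [k * (q + 1)]; what remains is the number of elements outside [A], so each of their counts is
    1. *)
Lemma coset_count_line x : x \notin A -> coset_count D A x = 1.
Proof.
have c_gt0 y : 0 < coset_count D A y.
  by rewrite lt0n; apply: contra_eqN (cA_mod y) => /eqP->; rewrite mod0n modn_small.
have sumA : \sum_(y in A) coset_count D A y = (q + 1) * (q + 1).
  rewrite -{1}cardA -sum_nat_const; apply: eq_bigr => y yA.
  by rewrite /coset_count lcoset_id // (setIidPr line_subset) cardA.
have sumNA : \sum_(y | y \notin A) coset_count D A y = \sum_(y | y \notin A) 1.
  have := sum_coset_count abG A dsD; rewrite (bigID [in A]) /= sumA cardA => E.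
  have : \sum_(y : gT) 1 = v by rewrite sum1_card cardG.
  rewrite (bigID [in A]) /= sum1_card cardA => F.
  apply/eqP; rewrite -(eqn_add2l ((q + 1) * (q + 1))) E.
  rewrite -(eqn_add2l (q + 1)) addnCA F; apply/eqP; ring.
move=> xA; have /eqP : \sum_(y | y \notin A) (coset_count D A y - 1) = 0.
  by rewrite sumnB ?sumNA ?subnn.
rewrite sum_nat_eq0 => /forallP/(_ x); rewrite xA /= subn_eq0 => c_le1.
by apply/eqP; rewrite eqn_leq c_le1 c_gt0.
Qed.

(* Writing the counts as [1 + q u], both [u] and [u ^ 2] sum to [q |B|], so [u]
   is 0 on a single coset of [B]; that coset is closed under inversion. *)
Lemma coset_count_ovoid : coset_count D B 1%g = 1.
Proof.
pose u x := coset_count D B x %/ q.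
have cE x : coset_count D B x = 1 + q * u x.
  by rewrite {1}(divn_eq (coset_count D B x) q) cB_mod modn_small // mulnC addnC.
have sum_u : \sum_x u x = q * (q ^ 2 + 1).
  have := sum_coset_count abG B dsD; rewrite cardB.
  under eq_bigr => x _ do rewrite cE.
  rewrite big_split /= sum1_card cardG -big_distrr /= => E.
  apply/eqP; rewrite -(eqn_pmul2l q_gt0) -(eqn_add2l v) E; apply/eqP; ring.
have sum_u2 : \sum_x u x ^ 2 = q * (q ^ 2 + 1).
  have := sum_sqr_coset_count abG B dsD k_eq; rewrite cardB.
  have -> : \sum_x coset_count D B x ^ 2 = v + 2 * q * (\sum_x u x) + q ^ 2 * (\sum_x u x ^ 2).
    rewrite -cardG -sum1_card !big_distrr -!big_split /=; apply: eq_bigr => x _.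
    rewrite cE; ring.
  rewrite sum_u [2 * s]mulnC expnM -qE => E.
  have q2_gt0 : 0 < q ^ 2 by rewrite expn_gt0 q_gt0.
  apply/eqP; rewrite -(eqn_pmul2l q2_gt0) -(eqn_add2l (v + 2 * q * (q * (q ^ 2 + 1)))) E.
  apply/eqP; ring.
(* The terms [u x ^ 2 - u x] are nonnegative and sum to 0. *)
have u_le1 x : u x <= 1.
  have : \sum_x (u x ^ 2 - u x) = 0.
    rewrite sumnB ?sum_u ?sum_u2 ?subnn // => y _.
    by case: (u y) => // n; rewrite -mulnn leq_pmulr.
  move/eqP; rewrite sum_nat_eq0 => /forallP/(_ x) /=.
  by rewrite subn_eq0; case: (u x) => [|[|n]] //; rewrite -mulnn -[X in _ <= X]muln1 leq_pmul2l.
pose Z := [set x | u x == 0].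
have cardZ : #|Z| = q ^ 2 + 1.
  have : \sum_x ((u x == 0) + u x) = v.
    rewrite -cardG -sum1_card; apply: eq_bigr => x _.
    by case: (u x) (u_le1 x) => [|[]].
  rewrite big_split /= sum_u => E; apply/eqP.
  rewrite -(eqn_add2r (q * (q ^ 2 + 1))); apply/eqP; rewrite -[RHS]/(_ + _).
  etransitivity; last by (etransitivity; [exact: E | ring]).
  congr (_ + _); rewrite -sum1_card big_mkcond /=.
  by apply: eq_bigr => x _; rewrite inE; case: (u x == 0).
have [z zZ] : exists z, z \in Z by apply/card_gt0P; rewrite cardZ addn1.
have u_coset x y : (x^-1 * y)%g \in B -> u x = u y.
  rewrite -mem_lcoset => xy; rewrite /u /coset_count.
  by rewrite (lcoset_eqP xy).
have ZE : Z = (z *: B)%g.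
  apply/esym/eqP; rewrite eqEcard card_lcoset cardB cardZ leqnn andbT.
  apply/subsetP=> y; rewrite mem_lcoset => /u_coset zy.
  by move: zZ; rewrite !inE zy.
have : z^-1%g \in Z by move: zZ; rewrite !inE /u symB.
rewrite ZE mem_lcoset -invMg groupV => z2B.
(* The group order is odd, so [z] is a power of its square, which lies in [B]. *)
have zB : z \in B.
  have -> : z = (sqg z ^+ (#|gT|.+1./2))%g.
    rewrite /sqg -expgM mulnC muln2 halfK /= oddG /= subn0.
    by rewrite expgS expg_card_type mulg1.
  by rewrite groupX.
have : u 1%g = 0.
  by apply/eqP; have : 1%g \in Z; [rewrite ZE lcoset_id | rewrite inE].
by rewrite cE => ->; rewrite muln0.
Qed.

(** As [s] is odd, [q ^ 2 = 4 ^ s] is 4 modulo 5; likewise [q = 2 ^ s] is 2 modulo 3 in [dvd3A]. *)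
Let dvd5B : 5 %| q ^ 2 + 1.
Proof.
have -> : q ^ 2 = 16 ^ s./2 * 4.
  by rewrite qE -expnM -{1}(odd_double_half s) odd_s -mul2n mulnDl mul1n mulnAC
     expnD (expnM 2 4) mulnC.
by rewrite /dvdn -modnDml -modnMml -modnXm exp1n.
Qed.

Let dvd3A : 3 %| q + 1.
Proof.
have -> : q = 4 ^ s./2 * 2.
  by rewrite qE -{1}(odd_double_half s) odd_s -mul2n expnD (expnM 2 2) mulnC.
by rewrite /dvdn -modnDml -modnMml -modnXm exp1n.
Qed.

Lemma line_coset_unique x y :
  x \notin A -> x \in D -> y \in D -> (x^-1 * y)%g \in A -> y = x.
Proof.
move=> xA xD yD xyA.
have /eqP/cards1P[z Dz] := coset_count_line xA.
have /set1P -> : y \in [set z] by rewrite -Dz inE yD mem_lcoset.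
by apply/esym/set1P; rewrite -Dz inE xD mem_lcoset mulVg group1.
Qed.

Lemma ds_ovoid_trivial x : x \in D -> x \in B -> x = 1%g.
Proof.
move=> xD xB; have /eqP/cards1P[z Dz] := coset_count_ovoid.
have mem_z y : y \in D -> y \in B -> y = z.
  by move=> yD yB; apply/set1P; rewrite -Dz inE yD mem_lcoset invg1 mul1g.
by rewrite (mem_z x) // [RHS](mem_z 1%g) // (subsetP line_subset).
Qed.

Lemma exists_order15_off_line :
  exists d : gT, [/\ #[d]%g = 15, d \in D & d \notin A].
Proof.
have [||b _ b5] := @Cauchy gT 5 [set: gT]%G => //.
  by rewrite cardsT cardG dvdn_mull.
have bA : b \notin A.
  rewrite memA -order_dvdn b5; apply/negP=> dvd5A.
  by have := dvdn_gcd 5 (q + 1) (q ^ 2 + 1); rewrite dvd5A dvd5B (eqP coAB).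
have /eqP/cards1P[d Dd] := coset_count_line bA.
have /setIP[dD] : d \in D :&: (b *: A)%g by rewrite Dd set11.
rewrite mem_lcoset => bdA.
have dA : d \notin A.
  by apply: contra bA => dA; move: bdA; rewrite groupMr // groupV.
have d16 : (d ^+ 16 = d)%g.
  apply/set1P; rewrite -Dd inE (ds_pow2 4 dD) mem_lcoset.
  have bV : (b^-1 = b^-1 ^+ 16)%g.
    have b5V : (b^-1 ^+ 5 = 1)%g by rewrite expgVn -b5 expg_order invg1.
    by rewrite expgS (expgM _ 5 3) b5V expg1n mulg1.
  by rewrite {1}bV -expgMn ?groupX //; apply: mulgC_abelian.
have d15 : (d ^+ 15 = 1)%g by apply: (mulgI d); rewrite -expgS d16 mulg1.
exists d; split=> //.
(* Order 1 or 3 would put [d] in [A]; order 5 would put it in [D :&: B], making it 1 and again a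
   member of [A]. *)
have : #[d]%g \in divisors 15 by rewrite -dvdn_divisors // order_dvdn d15.
have d_not3 : ~~ (#[d]%g %| 3).
  by apply: contra dA => /dvdn_trans/(_ dvd3A); rewrite order_dvdn memA.
have d_not5 : ~~ (#[d]%g %| 5).
  apply: contra dA => /dvdn_trans/(_ dvd5B); rewrite order_dvdn -memB => dB.
  by rewrite (ds_ovoid_trivial dD dB).
rewrite (_ : divisors 15 = [:: 1; 3; 5; 15]) // !inE.
by case/or4P=> /eqP dE //; rewrite dE in d_not3 d_not5.
Qed.

Lemma mem_powers_order15 : exists2 d : gT,
  #[d]%g = 15 & forall i, i < 15 -> ((d ^+ i)%g \in D) = (i \in singer_exponents).
Proof.
have [d [ord_d dD dA]] := exists_order15_off_line; exists d => // i i15.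
have memAd j : 5 %| j -> (d ^+ j)%g \in A.
  case/dvdnP=> a ->; rewrite memA -expgM -order_dvdn ord_d.
  by rewrite (mulnC a) -mulnA (dvdn_pmul2l (p := 5) (d := 3)) // dvdn_mull.
have memBd j : 3 %| j -> (d ^+ j)%g \in B.
  case/dvdnP=> a ->; rewrite memB -expgM -order_dvdn ord_d.
  by rewrite (mulnC a) -mulnA (dvdn_pmul2l (p := 3) (d := 5)) // dvdn_mull.
have on_line j : 5 %| j -> (d ^+ j)%g \in D by move=> /memAd; apply: (subsetP line_subset).
have on_ovoid j : 3 %| j -> ~~ (15 %| j) -> (d ^+ j)%g \notin D.
  move=> /memBd jB j15; apply: contra j15 => jD.
  by rewrite -ord_d order_dvdn (ds_ovoid_trivial jD jB).
(* This element shares its coset of [A] with the power [2 ^ j] of [d], already the only point of [D]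
   there. *)
have off_line j r : ~~ (5 %| 2 ^ j) -> ~~ (15 %| 5 * r) -> (d ^+ (2 ^ j + 5 * r))%g \notin D.
  move=> j5 r15; apply: contra r15 => rD.
  have jA : (d ^+ (2 ^ j))%g \notin A.
    rewrite memA -expgM -order_dvdn ord_d; apply: contra j5 => j5.
    have : 5 %| 2 ^ j * (q + 1) by apply: dvdn_trans j5.
    by rewrite Gauss_dvdl // (coprime_dvdl dvd5B) // coprime_sym.
  have := line_coset_unique jA (ds_pow2 j dD) rD.
  rewrite expgD mulKg => /(_ (memAd _ (dvdn_mulr _ (dvdnn 5)))) E.
  by rewrite -ord_d order_dvdn; apply/eqP/(mulgI (d ^+ (2 ^ j))%g); rewrite mulg1.
have pow2 := fun j => ds_pow2 j dD.
(* Multiples of 5 lie on the line, and 1, 2, 4, 8 are powers of 2. Nonzero multiples of 3 lie in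
   [B]. The rest are 7 = 2 + 5, 11 = 1 + 10, 13 = 8 + 5 and 14 = 4 + 10. *)
do 15 (case: i i15 => [|i] i15; first by
  first [ exact: on_line | exact: (pow2 0) | exact: (pow2 1) | exact: (pow2 2)
        | exact: (pow2 3) | exact/negbTE/on_ovoid | exact/negbTE/(off_line 1 1)
        | exact/negbTE/(off_line 0 2) | exact/negbTE/(off_line 3 1)
        | exact/negbTE/(off_line 2 2)]).
by [].
Qed.

End OrderFifteen.

Lemma exists_order15_powers (gT : finGroupType) (abG : abelian [set: gT])
    (D : {set gT}) (s q : nat) :
    odd s -> q = 2 ^ s -> normalized D ->
    difference_set [set: gT] D ((q + 1) * (q ^ 2 + 1)) (q ^ 2 + q + 1) (q + 1) ->
  exists2 d : gT,
    #[d]%g = 15 & forall i, i < 15 -> ((d ^+ i)%g \in D) = (i \in singer_exponents).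
Proof.
move=> odd_s qE normD dsD; have cardG := card_type_ds dsD.
have co : coprime (q + 1) (q ^ 2 + 1) by apply: coprime_line_ovoid odd_s qE.
have [A [cardA memA]] := abelian_Hall_subgroup abG cardG co.
have [B [cardB memB]] : exists B : {group gT},
    #|B| = q ^ 2 + 1 /\ forall x, (x \in B) = (x ^+ (q ^ 2 + 1) == 1)%g.
  by apply: (@abelian_Hall_subgroup _ abG _ (q + 1));
     rewrite 1?mulnC 1?coprime_sym // cardG mulnC.
exact: (mem_powers_order15 abG odd_s qE normD dsD cardA memA cardB memB).
Qed.

(** * The explicit (15,7,3)-difference set and transport along injective morphisms *)

Lemma singer_difference_set (gT : finGroupType) (d : gT) (D : {set gT}) :
    #[d]%g = 15 ->
    (forall i, i < 15 -> ((d ^+ i)%g \in D) = (i \in singer_exponents)) ->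
  difference_set <[d]>%g (D :&: <[d]>%g) 15 7 3.
Proof.
move=> ord_d memD.
have expI i j : i < 15 -> j < 15 -> (d ^+ i == d ^+ j)%g = (i == j).
  by move=> i15 j15; rewrite eq_expg_mod_order ord_d !modn_small.
have lt15 i : i \in singer_exponents -> i < 15.
  by move: i; apply/allP.
pose L := singer_exponents.
have memDd x : reflect (exists2 i, i \in L & x = (d ^+ i)%g) (x \in D :&: <[d]>%g).
  apply: (iffP setIP) => [[xD /cyclePmin[i]]|[i iL ->]].
    by rewrite ord_d => i15 xE; exists i; rewrite // -memD // -xE.
  by rewrite memD ?lt15 // mem_cycle.
split; first exact: subsetIr.
- by rewrite -orderE ord_d.
- have -> : D :&: <[d]>%g = [set x in [seq (d ^+ i)%g | i <- L]].
    by apply/setP=> x; rewrite [RHS]inE; apply/memDd/mapP.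
  rewrite cardsE (card_uniqP _) ?size_map // map_inj_in_uniq // => i j iL jL /eqP.
  by rewrite expI ?lt15 // => /eqP.
(* Pairs of exponents with difference [j] modulo 15, as a list whose length is found by
   evaluation. *)
pose P j := [seq ij <- [seq (i, i') | i <- L, i' <- L] | ij.1 == (j + ij.2) %% 15].
have sizeP j : j < 15 -> 0 < j -> size (P j) = 3.
  by do 15 (case: j => [|j] //).
have memP j i i' : ((i, i') \in P j) = [&& i \in L, i' \in L & i == (j + i') %% 15].
  rewrite mem_filter; apply/andP/and3P => [[E /allpairsPdep[a [b [aL bL]]] ab]|[iL i'L E]].
    by case: ab => <- <- in aL bL *.
  by split=> //; apply/allpairsPdep; exists i, i'.
move=> _ /cyclePmin[j] + ->; rewrite ord_d => j15 j1.
have j_gt0 : 0 < j by rewrite lt0n; apply: contraNneq j1 => ->; rewrite expg0.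
have -> : [set p in setX (D :&: <[d]>%g) (D :&: <[d]>%g) | p.1 * p.2^-1 == d ^+ j]%g =
          [set p in [seq ((d ^+ ij.1)%g, (d ^+ ij.2)%g) | ij <- P j]].
  apply/setP=> -[x y]; rewrite [RHS]inE inE in_setX /=; apply/idP/mapP.
    case/andP=> /andP[/memDd[i iL ->] /memDd[i' i'L ->]] E.
    exists (i, i') => //; rewrite memP iL i'L /=.
    move: E; rewrite -(inj_eq (mulIg (d ^+ i')%g)) mulgKV -expgD.
    by rewrite eq_expg_mod_order ord_d modn_small ?lt15.
  case=> -[i i']; rewrite memP => /and3P[iL i'L /eqP iE] [-> ->].
  apply/andP; split; first by apply/andP; split; apply/memDd; [exists i | exists i'].
  by rewrite -(inj_eq (mulIg (d ^+ i')%g)) mulgKV -expgD eq_expg_mod_order ord_d iE modn_mod.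
rewrite cardsE (card_uniqP _) ?size_map ?sizeP //.
rewrite map_inj_in_uniq ?filter_uniq // => -[i1 i2] [j1' j2'].
rewrite !memP => /and3P[/lt15 i1L /lt15 i2L _] /and3P[/lt15 j1L /lt15 j2L _] [/eqP E1 /eqP E2].
by move: E1 E2; rewrite !expI // => /eqP -> /eqP ->.
Qed.

(** Serves to pass from [G] to the type [subg_of G], where the group is the full set as the group
    ring requires, and to return along [sgval]. *)
Lemma morphim_difference_set (aT rT : finGroupType) (G H : {group aT}) (D : {set aT})
    (f : {morphism G >-> rT}) (v k lam : nat) :
    ('injm f)%g -> H \subset G -> difference_set H D v k lam ->
  difference_set (f @* H)%g (f @: D) v k lam.
Proof.
move=> injf sHG [sDH cardH cardD reps].
have inj_on : {in G &, injective f} by apply/injmP.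
have inH : {in D, forall x, x \in G}.
  by move=> x xD; rewrite (subsetP sHG) // (subsetP sDH).
have imH : (f @* H)%g = f @: H by rewrite morphimEsub.
split.
- by rewrite imH imsetS.
- by rewrite card_injm.
- by rewrite card_in_imset // => x y xD yD; apply: inj_on; apply: inH.
move=> _ /morphimP[x xG xH ->] fx1.
have x1 : x != 1%g by apply: contraNneq fx1 => ->; rewrite morph1.
rewrite -(reps x xH x1) -[RHS](card_in_imset (f := fun p => (f p.1, f p.2))).
  apply: eq_card => -[a b]; rewrite inE in_setX /=; apply/idP/imsetP.
    case/andP=> /andP[/imsetP[c cD ->] /imsetP[e eD ->]] E.
    exists (c, e) => //; rewrite inE in_setX /= cD eD /=.
    have [cG eG] := (inH _ cD, inH _ eD).
    apply/eqP; apply: inj_on; rewrite ?groupM ?groupV //.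
    by rewrite morphM ?groupV // morphV // (eqP E).
  case=> -[c e]; rewrite inE in_setX /= => /andP[/andP[cD eD] /eqP E] [-> ->].
  have [cG eG] := (inH _ cD, inH _ eD).
  by rewrite !imset_f //= -morphV // -morphM ?groupV // E.
move=> [a b] [c e]; rewrite !inE /= => /andP[/andP[aD bD] _] /andP[/andP[cD eD] _] [E1 E2].
by congr (_, _); apply: inj_on; rewrite ?inH.
Qed.

Theorem theorem6p1 (gT : finGroupType) (G : {group gT}) (D : {set gT}) (s : nat) :
  odd s -> 0 < s -> abelian G ->
  difference_set G D ((2 ^ (4 * s) - 1) %/ (2 ^ s - 1))
                     ((2 ^ (3 * s) - 1) %/ (2 ^ s - 1))
                     ((2 ^ (2 * s) - 1) %/ (2 ^ s - 1)) ->
  normalized D ->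
  exists M : {group gT}, [/\ M \subset G, #|M| = 15 & difference_set M (D :&: M) 15 7 3].
Proof.
move=> odd_s s_gt0 abG dsD normD.
(* With [2 ^ s = r + 2], truncated subtraction of 1 is harmless and the three quotients become
   polynomial identities in [r]. *)
have [r qE] : exists r, 2 ^ s = r.+2.
  move: (ltn_exp2l 0 s (isT : 1 < 2)); rewrite s_gt0 expn0.
  by case: (2 ^ s) => [|[|r]] // _; exists r.
have divE a b : a = b * (2 ^ s - 1) -> a %/ (2 ^ s - 1) = b.
  by move=> ->; rewrite mulnK // qE.
have subE a b : a = b.+1 -> a - 1 = b by move=> ->; rewrite subn1.
rewrite (mulnC 4) (mulnC 3) (mulnC 2) !expnM in dsD.
rewrite (divE _ ((2 ^ s + 1) * ((2 ^ s) ^ 2 + 1))) in dsD; last first.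
  by apply: subE; rewrite qE subn1 /=; ring.
rewrite (divE _ ((2 ^ s) ^ 2 + 2 ^ s + 1)) in dsD; last first.
  by apply: subE; rewrite qE subn1 /=; ring.
rewrite (divE _ (2 ^ s + 1)) in dsD; last first.
  by apply: subE; rewrite qE subn1 /=; ring.
have sDG : D \subset G by case: dsD.
pose D' := subg G @: D.
have abG' : abelian [set: subg_of G] by rewrite -im_subg morphim_abelian.
have dsD' : difference_set [set: subg_of G] D' ((2 ^ s + 1) * ((2 ^ s) ^ 2 + 1))
    ((2 ^ s) ^ 2 + 2 ^ s + 1) (2 ^ s + 1).
  rewrite -im_subg; apply: (morphim_difference_set _ _ dsD) => //.
  exact: injm_subg.
have normD' : normalized D'.
  pose mulC : Monoid.com_law 1%g :=
    HB.pack (@mulg (subg_of G))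
      (SemiGroup.isCommutativeLaw.Build _ _ (mulgC_abelian abG')).
  rewrite /normalized (@big_imset _ 1%g mulC) /=; last first.
    move=> x y xD yD E.
    by rewrite -(subgK x (subsetP sDG x xD)) E subgK ?(subsetP sDG).
  transitivity (subg_morphism G (\prod_(y in D) y)%g); last by rewrite normD morph1.
  by rewrite morph_prod // => x xD; apply: (subsetP sDG).
have [d ord_d memD'] := exists_order15_powers abG' odd_s erefl normD' dsD'.
exists (sgval @* <[d]>)%G; split.
- by apply/subsetP=> _ /morphimP[x _ _ ->]; apply: subgP.
- by rewrite card_injm ?subsetT ?injm_sgval // -ord_d.
have -> : D :&: (sgval @* <[d]>)%g = sgval @: (D' :&: <[d]>%g).
  apply/setP=> x; apply/setIP/imsetP => [[xD /morphimP[y _ yM xE]]|[y /setIP[yD yM] ->]].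
    exists y => //; rewrite inE yM andbT -[y]sgvalK -xE.
    exact: imset_f.
  split; last by apply: mem_morphim; rewrite ?inE.
  by have /imsetP[z zD ->] := yD; rewrite subgK // (subsetP sDG).
apply: morphim_difference_set; rewrite ?injm_sgval ?subsetT //.
exact: singer_difference_set.
Qed.
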